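(* Let $\Phi\in\mathbb{R}^{m\times d}$ satisfy the restricted isometry condition with parameters $(2s,\delta)$, where $0\le\delta<\sqrt{2}-1$, and set $$\rho=\frac{\sqrt{2}\,\delta}{1-\delta},\qquad \alpha=\frac{2\sqrt{1+\delta}}{1-\delta}.$$ Let $x\in\mathbb{R}^d$ be an $s$-sparse vector with noisy measurements $u=\Phi x+e$, where $\|e\|_2\le\varepsilon$. Let $\mu$ be the smallest absolute value of a nonzero coordinate of $x$, and assume $$\mu\ge\frac{4\alpha\varepsilon}{1-\rho}.$$ Then the limiting approximation $\hat{x}$ from reweighted $\ell_1$-minimization with measurement vector $u$ and noise parameter $\varepsilon$ satisfies $$\|x-\hat{x}\|_2\le C''\varepsilon,\qquad C''=\frac{2\alpha}{1+\rho}.$$ That is, for every sequence of iterates $(\hat{x}_k)_{k\ge1}$ of reweighted $\ell_1$-minimization with measurement vector $u$, noise parameter $\varepsilon$ and stability parameters tending to $0$, one has $\limsup_{k\to\infty}\|x-\hat{x}_k\|_2\le C''\varepsilon$.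
   Context: A vector $z\in\mathbb{R}^d$ is $s$-sparse if it has at most $s$ nonzero coordinates. The matrix $\Phi\in\mathbb{R}^{m\times d}$ satisfies the restricted isometry condition with parameters $(r,\delta)$ if $(1-\delta)\|z\|_2^2\le\|\Phi z\|_2^2\le(1+\delta)\|z\|_2^2$ for all $r$-sparse $z\in\mathbb{R}^d$. Reweighted $\ell_1$-minimization with measurement vector $u\in\mathbb{R}^m$, noise parameter $\varepsilon\ge0$ and stability parameters $a_1,a_2,\dots>0$ is the following iteration. Start with weights $\delta_i^{(1)}=1$ for $i=1,\dots,d$. At step $k\ge1$, let $\hat{x}_k$ be a minimizer of $\sum_{i=1}^d\delta_i^{(k)}|z_i|$ over all $z\in\mathbb{R}^d$ with $\|\Phi z-u\|_2\le\varepsilon$; then set $\delta_i^{(k+1)}=\dfrac{1}{|(\hat{x}_k)_i|+a_k}$ for $i=1,\dots,d$. A bound on the limiting approximation means a bound on $\limsup_{k\to\infty}\|x-\hat{x}_k\|_2$, with the stability parameters taken to satisfy $a_k\to0$. *)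

(* Defs.v *)
From HB Require Import structures.
From mathcomp Require Import all_boot all_order all_algebra.
From mathcomp Require Import all_classical all_reals all_analysis.
Set Implicit Arguments.
Unset Strict Implicit.
Unset Printing Implicit Defensive.
Import Order.TTheory GRing.Theory Num.Theory.
Import numFieldNormedType.Exports.
Local Open Scope ring_scope.

(* The library norm `|z| on matrices is the sup norm, not this one. *)
Definition l2norm (R : realType) (n : nat) (z : 'cV[R]_n) : R :=
  Num.sqrt (\sum_(i < n) z i ord0 ^+ 2).

Definition sparse (R : realType) (n s : nat) (z : 'cV[R]_n) : Prop :=
  (#|[pred i : 'I_n | z i ord0 != 0%R]| <= s)%N.

Definition restricted_isometry (R : realType) (m d : nat)
    (Phi : 'M[R]_(m, d)) (r : nat) (delta : R) : Prop :=
  forall z : 'cV[R]_d, sparse r z ->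
    (1 - delta) * l2norm z ^+ 2 <= l2norm (Phi *m z) ^+ 2 /\
    l2norm (Phi *m z) ^+ 2 <= (1 + delta) * l2norm z ^+ 2.

(* The minimum over the empty set is +oo, so a lower bound on this quantity is
   no constraint on z = 0. *)
Definition min_nonzero_abs (R : realType) (n : nat) (z : 'cV[R]_n) : \bar R :=
  \big[mine/+oo%E]_(i < n | z i ord0 != 0) (`|z i ord0|)%:E.

Definition weighted_l1 (R : realType) (n : nat) (w : 'I_n -> R)
    (z : 'cV[R]_n) : R :=
  \sum_(i < n) w i * `|z i ord0|.

Definition weighted_l1_minimizer (R : realType) (m d : nat)
    (Phi : 'M[R]_(m, d)) (u : 'cV[R]_m) (eps : R) (w : 'I_d -> R)
    (y : 'cV[R]_d) : Prop :=
  l2norm (Phi *m y - u) <= eps /\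
  forall z : 'cV[R]_d, l2norm (Phi *m z - u) <= eps ->
    weighted_l1 w y <= weighted_l1 w z.

(* Steps are numbered from 0: weights, stability parameter and iterate of
   step k >= 1 carry the index k.-1. *)
Definition reweighted_weights (R : realType) (d : nat) (a : nat -> R)
    (xhat : nat -> 'cV[R]_d) (k : nat) (i : 'I_d) : R :=
  if k is j.+1 then (`|xhat j i ord0| + a j)^-1 else 1.

Definition reweighted_l1_iterates (R : realType) (m d : nat)
    (Phi : 'M[R]_(m, d)) (u : 'cV[R]_m) (eps : R) (a : nat -> R)
    (xhat : nat -> 'cV[R]_d) : Prop :=
  forall k : nat,
    weighted_l1_minimizer Phi u eps (reweighted_weights a xhat k) (xhat k).

(* Main.v *)
Require Import Defs.
From HB Require Import structures.
From mathcomp Require Import all_boot all_order all_algebra.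
From mathcomp Require Import all_classical all_reals all_analysis.
From mathcomp Require Import fintype finset ring lra.
Import Order.TTheory GRing.Theory Num.Theory.
Import numFieldNormedType.Exports.
Local Open Scope ring_scope.

Set Implicit Arguments.
Unset Strict Implicit.
Unset Printing Implicit Defensive.

(** Write h for the error of an iterate, T0 for the support of x, S for the
    union of T0 and of the s largest entries of h outside T0. Three facts make
    the theorem true.

    - Optimality of a weighted l1 minimizer forces its error into a cone: the
      l1 mass of h off T0 is at most C times its l1 mass on T0, where C is the
      ratio of the largest weight on T0 to the smallest weight off T0
      ([weighted_l1_cone]).

    - Restricted isometry turns a cone condition into an error bound
      ([cone_error_bound]). Cut the complement of T0 into blocks of s entries of
      decreasing size; the l2 norm of each block is at most s^(-1/2) times the
      l1 norm of the preceding one ([shelling_bound]), and the images of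
      disjoint s-sparse vectors are nearly orthogonal ([rip_cross_le]). With
      N = ||h_S||_2 this yields (1 - rho C) N <= alpha eps, |h_i| <= N for
      all i, and ||h||_2^2 <= (1 + C^2) N^2.

    - If the entries of the current error are at most A in absolute value and
      the nonzero entries of x are at least M = 4 alpha eps / (1 - rho), then
      the next iterate satisfies the cone condition with any C such that
      A + a_k <= C (M - A + a_k).

    The first step has C = 1, so A = M / 4, and this persists at every later
    step whatever the stability parameters are. Once a_k is small, A = M / 4
    gives C = 2/5 at the following step, and the resulting smaller A gives
    C = (1 - rho) / 2 one step later; for this C the error is at most
    2 alpha eps / (1 + rho). So the bound holds for all large k, not only in
    the limit.

    The entries of the error have to be controlled by N and not by the cruder
    bound (1 + C) N on ||h||_2: iterating the latter when the smallest nonzero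
    entry equals M starts at M / 2, a fixed point of the recursion that exceeds
    the claimed bound as soon as rho and eps are positive. *)

(** * Euclidean norm and inner product *)

(** The Euclidean inner product of two column vectors. *)
Definition dotp (R : realType) (n : nat) (u v : 'cV[R]_n) : R :=
  \sum_i u i ord0 * v i ord0.

(** The vector that agrees with [z] on the index set [B] and vanishes elsewhere;
    the dimension is kept, so that a matrix can be applied to it. *)
Definition restrict_to (R : realType) (n : nat) (B : {set 'I_n})
    (z : 'cV[R]_n) : 'cV[R]_n :=
  \col_i (if i \in B then z i ord0 else 0).

Section EuclideanNorm.
Variables (R : realType) (n : nat).
Implicit Types u v z : 'cV[R]_n.

Lemma l2norm_ge0 z : 0 <= l2norm z.
Proof. exact: sqrtr_ge0. Qed.

Lemma sqr_l2norm z : l2norm z ^+ 2 = \sum_i z i ord0 ^+ 2.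
Proof. by rewrite sqr_sqrtr // sumr_ge0 // => i _; exact: sqr_ge0. Qed.

Lemma dotp0l z : dotp 0 z = 0.
Proof. by rewrite /dotp big1 // => i _; rewrite mxE mul0r. Qed.

Lemma dotp0r z : dotp z 0 = 0.
Proof. by rewrite /dotp big1 // => i _; rewrite [X in _ * X]mxE mulr0. Qed.

Lemma dotpDl u v z : dotp (u + v) z = dotp u z + dotp v z.
Proof. by rewrite -big_split /=; apply: eq_bigr => i _; rewrite mxE mulrDl. Qed.

Lemma dotpDr u v z : dotp z (u + v) = dotp z u + dotp z v.
Proof. by rewrite -big_split /=; apply: eq_bigr => i _; rewrite mxE mulrDr. Qed.

Lemma sqr_l2norm_lin (p q : R) u v :
  l2norm (p *: u + q *: v) ^+ 2 =
  p ^+ 2 * l2norm u ^+ 2 + 2 * p * q * dotp u v + q ^+ 2 * l2norm v ^+ 2.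
Proof.
rewrite !sqr_l2norm /dotp !mulr_sumr -!big_split /=.
by apply: eq_bigr => i _; rewrite !mxE; ring.
Qed.

Lemma sqr_l2normD u v :
  l2norm (u + v) ^+ 2 = l2norm u ^+ 2 + 2 * dotp u v + l2norm v ^+ 2.
Proof.
have := sqr_l2norm_lin 1 1 u v.
by rewrite !scale1r => ->; rewrite expr1n !mul1r !mulr1.
Qed.

Lemma l2norm_eq0 z : l2norm z = 0 -> z = 0.
Proof.
move=> z0; have: \sum_i z i ord0 ^+ 2 = 0 by rewrite -sqr_l2norm z0 expr0n.
move/eqP; rewrite psumr_eq0 => [/allP z2|i _]; last exact: sqr_ge0.
apply/matrixP => i j; rewrite ord1 mxE; apply/eqP.
by rewrite -sqrf_eq0; apply: z2; rewrite mem_index_enum.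
Qed.

Lemma le_l2norm z (b : R) : 0 <= b -> l2norm z ^+ 2 <= b ^+ 2 -> l2norm z <= b.
Proof. by move=> b0; rewrite ler_pXn2r // ?nnegrE ?l2norm_ge0. Qed.

(** Cauchy-Schwarz, from the square of [||v|| u - ||u|| v] being nonnegative. *)
Lemma dotp_le u v : dotp u v <= l2norm u * l2norm v.
Proof.
have [u0|u0] := eqVneq (l2norm u) 0.
  by rewrite u0 mul0r (l2norm_eq0 u0) dotp0l.
have [v0|v0] := eqVneq (l2norm v) 0.
  by rewrite v0 mulr0 (l2norm_eq0 v0) dotp0r.
have up : 0 < l2norm u by rewrite lt_def u0 l2norm_ge0.
have vp : 0 < l2norm v by rewrite lt_def v0 l2norm_ge0.
have := sqr_ge0 (l2norm (l2norm v *: u + (- l2norm u) *: v)).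
rewrite sqr_l2norm_lin => H.
have : 0 <= (l2norm u * l2norm v) * (l2norm u * l2norm v - dotp u v) by nra.
by rewrite pmulr_rge0 ?mulr_gt0 // subr_ge0.
Qed.

Lemma l2normN z : l2norm (- z) = l2norm z.
Proof. by congr Num.sqrt; apply: eq_bigr => i _; rewrite mxE sqrrN. Qed.

Lemma dotpNl u v : dotp (- u) v = - dotp u v.
Proof. by rewrite -sumrN; apply: eq_bigr => i _; rewrite mxE mulNr. Qed.

Lemma l2normD_le u v : l2norm (u + v) <= l2norm u + l2norm v.
Proof.
apply: le_l2norm; first by rewrite addr_ge0 ?l2norm_ge0.
by rewrite sqr_l2normD; have := dotp_le u v; lra.
Qed.

End EuclideanNorm.

(** * Restriction of a vector to a set of indices *)

Section Restriction.
Variables (R : realType) (n : nat).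
Implicit Types (z : 'cV[R]_n) (A B : {set 'I_n}).

Lemma sqr_l2norm_restrict B z :
  l2norm (restrict_to B z) ^+ 2 = \sum_(i in B) z i ord0 ^+ 2.
Proof.
rewrite sqr_l2norm [RHS]big_mkcond /=; apply: eq_bigr => i _; rewrite mxE.
by case: ifP => // _; rewrite expr0n.
Qed.

Lemma restrict_toU A B z : [disjoint A & B] ->
  restrict_to (A :|: B) z = restrict_to A z + restrict_to B z.
Proof.
move=> dAB; apply/matrixP => i j; rewrite !mxE inE.
have [iA|_] /= := boolP (i \in A); last by rewrite add0r.
by rewrite (disjointFr dAB iA) addr0.
Qed.

Lemma restrict_toC B z : restrict_to B z + restrict_to (~: B) z = z.
Proof.
apply/matrixP => i j; rewrite !mxE inE (ord1 j).
by case: ifP => _ /=; rewrite ?addr0 ?add0r.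
Qed.

Lemma dotp_restrict_disjoint A B z : [disjoint A & B] ->
  dotp (restrict_to A z) (restrict_to B z) = 0.
Proof.
move=> dAB; rewrite /dotp big1 // => i _; rewrite !mxE.
by case: ifP => [/(disjointFr dAB) ->|_]; rewrite ?mulr0 ?mul0r.
Qed.

Lemma sqr_l2norm_restrictU A B z : [disjoint A & B] ->
  l2norm (restrict_to (A :|: B) z) ^+ 2 =
  l2norm (restrict_to A z) ^+ 2 + l2norm (restrict_to B z) ^+ 2.
Proof.
move=> dAB; rewrite restrict_toU // sqr_l2normD.
by rewrite dotp_restrict_disjoint // mulr0 addr0.
Qed.

Lemma sparse_restrict s B z : (#|B| <= s)%N -> sparse s (restrict_to B z).
Proof.
apply: leq_trans; apply: subset_leq_card; apply/subsetP => i.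
by rewrite inE mxE; case: ifP => //; rewrite eqxx.
Qed.

Lemma normr_le_restrict B z i : i \in B ->
  `|z i ord0| <= l2norm (restrict_to B z).
Proof.
move=> iB; rewrite -[X in X <= _]normr_id -ler_sqr ?nnegrE ?l2norm_ge0 //.
rewrite normr_id real_normK ?num_real // sqr_l2norm_restrict (bigD1 i) //=.
by rewrite lerDl sumr_ge0 // => j _; exact: sqr_ge0.
Qed.

Lemma l1_restrict_le s B z : (#|B| <= s)%N ->
  \sum_(i in B) `|z i ord0| <= Num.sqrt s%:R * l2norm (restrict_to B z).
Proof.
move=> cB; pose w : 'cV[R]_n := \col_i (if i \in B then 1 else 0).
have := dotp_le w (restrict_to B (map_mx Num.norm z)).
have -> : dotp w (restrict_to B (map_mx Num.norm z)) =
    \sum_(i in B) `|z i ord0|.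
  rewrite /dotp [RHS]big_mkcond /=; apply: eq_bigr => i _; rewrite !mxE.
  by case: ifP => _; rewrite ?mul1r ?mul0r.
have -> : l2norm (restrict_to B (map_mx Num.norm z)) = l2norm (restrict_to B z).
  congr Num.sqrt; apply: eq_bigr => i _; rewrite !mxE.
  by case: ifP => // _; rewrite real_normK ?num_real.
move=> /le_trans; apply; apply: ler_wpM2r; first exact: l2norm_ge0.
apply: ler_wsqrtr.
rewrite (eq_bigr (fun i => if i \in B then 1 else 0)); last first.
  by move=> i _; rewrite !mxE; case: ifP => _; rewrite ?expr1n ?expr0n.
by rewrite -big_mkcond /= sumr_const ler_nat.
Qed.

End Restriction.

(** * Decomposition into blocks of decreasing entries *)

Section Shelling.
Variables (R : realType) (n : nat).
Implicit Types (z : 'cV[R]_n) (A B T U : {set 'I_n}).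

Lemma exists_largest_entries z s U : (s <= #|U|)%N ->
  exists T, [/\ T \subset U, #|T| = s &
    forall i j, i \in U :\: T -> j \in T -> `|z i ord0| <= `|z j ord0|].
Proof.
elim: s => [_|s IH sU].
  exists set0; split; rewrite ?sub0set ?cards0 // => i j _.
  by rewrite inE.
have [T [TU cT zT]] := IH (ltnW sU).
have /set0Pn [k0 k0P] : U :\: T != set0.
  by rewrite -card_gt0 cardsD (setIidPr TU) cT subn_gt0.
have [k kP kmax] := arg_maxP (fun i => `|z i ord0|) k0P.
have /setDP[kU kT] : k \in U :\: T by exact: kP.
exists (k |: T); split.
- by rewrite subUset sub1set kU.
- by rewrite cardsU1 kT cT.
move=> i j; rewrite !inE negb_or => /andP[/andP[ik iT] iU] /orP[/eqP ->|jT].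
  by apply: kmax; apply/setDP; split.
by apply: zT => //; rewrite inE iT.
Qed.

(** [T] consists of the [s] largest entries of [z] in [U], or is [U] when [U]
    has at most [s] elements. The blocks into which the rest of [U] is cut are
    not named: they are consumed through an arbitrary subadditive set function
    [G] that is at most [K * ||z_B||_2] on sets [B] of size at most [s]. Since
    [T] is chosen before [G], [G] may depend on [T]. *)
Lemma shelling_bound z s U : (0 < s)%N ->
  exists T, [/\ T \subset U, (#|T| <= s)%N,
    forall i, i \in U -> `|z i ord0| <= l2norm (restrict_to T z) &
    forall (K : R) (G : {set 'I_n} -> R), 0 <= K ->
      (forall A B, [disjoint A & B] -> G (A :|: B) <= G A + G B) ->
      (forall B, B \subset U :\: T -> (#|B| <= s)%N ->
        G B <= K * l2norm (restrict_to B z)) ->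
      Num.sqrt s%:R * G (U :\: T) <= K * \sum_(i in U) `|z i ord0|].
Proof.
move=> s0; have [m] := ubnP #|U|; elim: m U => // m IH U; rewrite ltnS => Um.
have [cU|cU] := leqP #|U| s.
  exists U; split => // [i iU|K G K0 _ GB]; first exact: normr_le_restrict.
  rewrite setDv; have G0 := GB set0 (sub0set _) _.
  rewrite cards0 in G0; have {G0} := G0 isT.
  have -> : l2norm (restrict_to set0 z) = 0.
    by apply/eqP; rewrite -sqrf_eq0 sqr_l2norm_restrict big_set0.
  rewrite mulr0 => G0; apply: (@le_trans _ _ 0).
    by rewrite mulr_ge0_le0 ?sqrtr_ge0.
  by rewrite mulr_ge0 ?sumr_ge0.
have [T [TU cT zT]] := exists_largest_entries z (ltnW cU).
have cUT : (#|U :\: T| < m)%N.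
  rewrite cardsD (setIidPr TU) cT (leq_trans _ Um) // ltn_subrL s0.
  exact: leq_ltn_trans cU.
have [T' [T'U cT' _ HT']] := IH _ cUT.
have /card_gt0P [j0 j0T] : (0 < #|T|)%N by rewrite cT.
exists T; split => //; first by rewrite cT.
  move=> i iU; have [iT|iT] := boolP (i \in T); first exact: normr_le_restrict.
  apply: (le_trans (zT i j0 _ j0T)); first by rewrite inE iT.
  exact: normr_le_restrict.
move=> K G K0 Gsub GB.
have splitU : U :\: T = T' :|: ((U :\: T) :\: T').
  by rewrite -{1}[U :\: T](setID _ T') (setIidPr T'U).
have dT' : [disjoint T' & (U :\: T) :\: T'].
  by rewrite disjoint_sym disjoints_subset setDE subsetIr.
have H1 : Num.sqrt s%:R * G ((U :\: T) :\: T') <=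
    K * \sum_(i in U :\: T) `|z i ord0|.
  apply: HT' => // B BT' cB; apply: GB => //.
  exact: subset_trans BT' (subsetDl _ _).
(* Each entry on T' is at most the smallest entry on T, and T has s entries. *)
have H2 : Num.sqrt s%:R * l2norm (restrict_to T' z) <= \sum_(i in T) `|z i ord0|.
  have [j jT jmin] := arg_minP (fun i => `|z i ord0|) j0T.
  have T'le : l2norm (restrict_to T' z) <= Num.sqrt s%:R * `|z j ord0|.
    apply: le_l2norm; first by rewrite mulr_ge0 ?sqrtr_ge0.
    rewrite sqr_l2norm_restrict exprMn sqr_sqrtr ?ler0n //.
    apply: (@le_trans _ _ (\sum_(i in T') `|z j ord0| ^+ 2)).
      apply: ler_sum => i iT'; rewrite -[X in X <= _]real_normK ?num_real //.
      by rewrite ler_sqr ?nnegrE // zT // (subsetP T'U).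
    by rewrite sumr_const -[X in X <= _]mulr_natl ler_wpM2r ?sqr_ge0 ?ler_nat.
  apply: (@le_trans _ _ (s%:R * `|z j ord0|)).
    rewrite -[s%:R in leRHS](@sqr_sqrtr R) ?ler0n // expr2 -mulrA.
    by rewrite ler_wpM2l ?sqrtr_ge0.
  by rewrite mulr_natl -cT -sumr_const; apply: ler_sum => i /jmin.
have H3 : G T' <= K * l2norm (restrict_to T' z) by apply: GB.
have H4 := Gsub _ _ dT'; rewrite -splitU in H4.
have sums : \sum_(i in U) `|z i ord0| =
    \sum_(i in T) `|z i ord0| + \sum_(i in U :\: T) `|z i ord0|.
  rewrite (big_setID T) /=; congr (_ + _).
  by apply: eq_bigl => i; rewrite (setIidPr TU).
rewrite sums mulrDr.
apply: (le_trans (ler_wpM2l (sqrtr_ge0 _) H4)); rewrite mulrDr lerD //.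
apply: (le_trans (ler_wpM2l (sqrtr_ge0 _) H3)).
by rewrite mulrCA ler_wpM2l.
Qed.

End Shelling.

(** * Consequences of restricted isometry *)

Section RestrictedIsometry.
Variables (R : realType) (m n s : nat) (Phi : 'M[R]_(m, n)) (delta : R).
Hypotheses (delta0 : 0 <= delta)
  (rip : restricted_isometry Phi (2 * s) delta).
Implicit Types (z h : 'cV[R]_n) (A B T : {set 'I_n}).

(** Near orthogonality of the images of disjointly supported sparse vectors, by
    polarization: with [u = z_A] and [v = z_B], restricted isometry is applied
    to [||v|| u + ||u|| v] and [||v|| u - ||u|| v], which have equal norms. *)
Lemma rip_cross_le z A B : [disjoint A & B] -> (#|A| <= s)%N -> (#|B| <= s)%N ->
  dotp (Phi *m restrict_to A z) (Phi *m restrict_to B z) <=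
  delta * l2norm (restrict_to A z) * l2norm (restrict_to B z).
Proof.
move=> dAB cA cB; set u := restrict_to A z; set v := restrict_to B z.
have uv0 : dotp u v = 0 by exact: dotp_restrict_disjoint.
have sp p q : sparse (2 * s) (p *: u + q *: v).
  apply: (@leq_trans #|A :|: B|).
    apply: subset_leq_card; apply/subsetP => i; rewrite !inE /u /v !mxE.
    case: (i \in A) => //=; case: (i \in B) => //=.
    by rewrite !mulr0 addr0 eqxx.
  by rewrite (leq_trans (leq_card_setU _ _).1) // mul2n -addnn leq_add.
have [u0|u0] := eqVneq (l2norm u) 0.
  by rewrite (l2norm_eq0 u0) mulmx0 dotp0l !mulr_ge0 ?l2norm_ge0.
have [v0|v0] := eqVneq (l2norm v) 0.
  by rewrite (l2norm_eq0 v0) mulmx0 dotp0r !mulr_ge0 ?l2norm_ge0.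
have up : 0 < l2norm u by rewrite lt_def u0 l2norm_ge0.
have vp : 0 < l2norm v by rewrite lt_def v0 l2norm_ge0.
have [_] := rip (sp (l2norm v) (l2norm u)).
have [+ _] := rip (sp (l2norm v) (- l2norm u)).
rewrite !mulmxDr -!scalemxAr !sqr_l2norm_lin uv0.
set D := dotp _ _; set a := l2norm u in up *; set b := l2norm v in vp *.
move=> H1 H2.
have : 0 <= (a * b) * (delta * a * b - D) by nra.
by rewrite pmulr_rge0 ?mulr_gt0 // subr_ge0.
Qed.

Lemma rip_crossN_le z A B : [disjoint A & B] -> (#|A| <= s)%N -> (#|B| <= s)%N ->
  - dotp (Phi *m restrict_to A z) (Phi *m restrict_to B z) <=
  delta * l2norm (restrict_to A z) * l2norm (restrict_to B z).
Proof.
move=> dAB cA cB.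
(* The sign is absorbed by flipping z on A. *)
pose y : 'cV[R]_n := \col_i (if i \in A then - z i ord0 else z i ord0).
have := @rip_cross_le y A B dAB cA cB.
have -> : restrict_to A y = - restrict_to A z.
  by apply/matrixP => i j; rewrite !mxE; case: (i \in A); rewrite ?oppr0.
have -> : restrict_to B y = restrict_to B z.
  apply/matrixP => i j; rewrite !mxE; case: ifP => // iB.
  by rewrite (disjointFl dAB iB).
by rewrite mulmxN dotpNl l2normN.
Qed.

(** The witness [N] is the norm of [h] restricted to [T0] and to the [s] largest
    entries off [T0]. For [s = 0] the cone condition gives [h = 0]. *)
Lemma cone_error_bound (eps C : R) h T0 : 0 <= C -> (#|T0| <= s)%N ->
  \sum_(i in ~: T0) `|h i ord0| <= C * \sum_(i in T0) `|h i ord0| ->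
  l2norm (Phi *m h) <= 2 * eps ->
  exists N, [/\ 0 <= N,
    (1 - delta - Num.sqrt 2 * delta * C) * N <= 2 * Num.sqrt (1 + delta) * eps,
    forall i, `|h i ord0| <= N &
    l2norm h ^+ 2 <= (1 + C ^+ 2) * N ^+ 2].
Proof.
move=> C0 cT0 cone feas.
have eps0 : 0 <= eps.
  by have := le_trans (l2norm_ge0 _) feas; rewrite pmulr_rge0.
have [s0|s_gt0] := posnP s.
  have h0 i : h i ord0 = 0.
    have T00 : T0 = set0 by apply/eqP; rewrite -cards_eq0 -leqn0 -s0.
    move: cone; rewrite T00 big_set0 mulr0 setC0.
    rewrite (bigD1 i) ?inE //= => le0; apply/eqP; rewrite -normr_le0.
    by apply: le_trans le0; rewrite lerDl sumr_ge0.
  exists 0; split => //; first by rewrite mulr0 !mulr_ge0 ?sqrtr_ge0.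
    by move=> i; rewrite h0 normr0.
  by rewrite expr0n mulr0 sqr_l2norm big1 // => i _; rewrite h0 expr0n.
have [T [TT0 cT Tmax shell]] := shelling_bound h (~: T0) s_gt0.
have dT0T : [disjoint T0 & T] by rewrite disjoint_sym disjoints_subset.
set S := T0 :|: T; have SC : ~: S = ~: T0 :\: T by rewrite setCU setDE.
pose N := l2norm (restrict_to S h).
pose a := l2norm (restrict_to T0 h); pose b := l2norm (restrict_to T h).
have N0 : 0 <= N by exact: l2norm_ge0.
have a0 : 0 <= a by exact: l2norm_ge0.
have b0 : 0 <= b by exact: l2norm_ge0.
have NE : N ^+ 2 = a ^+ 2 + b ^+ 2 by exact: sqr_l2norm_restrictU.
have aN : a <= N by rewrite -ler_sqr ?nnegrE // NE lerDl sqr_ge0.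
have bN : b <= N by rewrite -ler_sqr ?nnegrE // NE lerDr sqr_ge0.
have abN : a + b <= Num.sqrt 2 * N.
  rewrite -ler_sqr ?nnegrE ?addr_ge0 ?mulr_ge0 ?sqrtr_ge0 //.
  rewrite exprMn sqr_sqrtr ?ler0n // NE.
  by have := sqr_ge0 (a - b); nra.
have rs0 : 0 < Num.sqrt s%:R :> R by rewrite sqrtr_gt0 ltr0n.
have tail1 : \sum_(i in ~: T0) `|h i ord0| <= C * (Num.sqrt s%:R * N).
  apply: le_trans cone _; rewrite ler_wpM2l //.
  by apply: le_trans (l1_restrict_le h cT0) _; rewrite ler_wpM2l ?sqrtr_ge0.
(* The tail off S in norm, and its inner product with the part on S. *)
have tail2 : l2norm (restrict_to (~: S) h) <= C * N.
  rewrite -(ler_pM2l rs0) [leRHS]mulrCA; apply: le_trans tail1.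
  rewrite SC -[leRHS]mul1r.
  apply: (shell 1 (fun B => l2norm (restrict_to B h))) => //.
    by move=> A B dAB; rewrite restrict_toU // l2normD_le.
  by move=> B _ _; rewrite mul1r.
pose G B := - dotp (Phi *m restrict_to S h) (Phi *m restrict_to B h).
have K0 : 0 <= Num.sqrt 2 * delta * N by rewrite !mulr_ge0 ?sqrtr_ge0.
have tailG : G (~: S) <= Num.sqrt 2 * delta * C * N ^+ 2.
  have -> : Num.sqrt 2 * delta * C * N ^+ 2 = Num.sqrt 2 * delta * N * (C * N).
    by ring.
  rewrite -(ler_pM2l rs0) [leRHS]mulrCA [Num.sqrt s%:R * (C * N)]mulrCA.
  apply: le_trans (ler_wpM2l K0 tail1).
  rewrite SC; apply: (shell _ G) => // [A B dAB|B BS cB].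
    by rewrite /G restrict_toU // mulmxDr dotpDr opprD.
  have [BT0 BT] : [disjoint T0 & B] /\ [disjoint T & B].
    rewrite ![[disjoint _ & B]]disjoint_sym !disjoints_subset; split.
      exact: subset_trans BS (subsetDl _ _).
    by apply: subset_trans BS _; rewrite setDE subsetIr.
  rewrite /G restrict_toU // mulmxDr dotpDl opprD.
  apply: le_trans (lerD (rip_crossN_le h BT0 cT0 cB) (rip_crossN_le h BT cT cB)) _.
  rewrite -mulrDl ler_wpM2r ?l2norm_ge0 // -mulrDr.
  by rewrite [Num.sqrt 2 * _]mulrC -mulrA ler_wpM2l.
have [low up] : (1 - delta) * N ^+ 2 <= l2norm (Phi *m restrict_to S h) ^+ 2 /\
    l2norm (Phi *m restrict_to S h) ^+ 2 <= (1 + delta) * N ^+ 2.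
  apply: rip; apply: sparse_restrict.
  by rewrite (leq_trans (leq_card_setU _ _).1) // mul2n -addnn leq_add.
have upN : l2norm (Phi *m restrict_to S h) <= Num.sqrt (1 + delta) * N.
  apply: le_l2norm; first by rewrite mulr_ge0 ?sqrtr_ge0.
  by rewrite exprMn (@sqr_sqrtr _ (1 + delta)) // addr_ge0.
have split2 : l2norm (Phi *m restrict_to S h) ^+ 2 =
    dotp (Phi *m restrict_to S h) (Phi *m h) + G (~: S).
  rewrite -{3}(restrict_toC S h) mulmxDr dotpDr addrK sqr_l2norm.
  by apply: eq_bigr => i _; rewrite expr2.
have cross : dotp (Phi *m restrict_to S h) (Phi *m h) <=
    Num.sqrt (1 + delta) * N * (2 * eps).
  by apply: le_trans (dotp_le _ _) _; rewrite ler_pM ?l2norm_ge0.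
exists N; split => //.
- have [->|Nn0] := eqVneq N 0; first by rewrite mulr0 !mulr_ge0 ?sqrtr_ge0.
  have Np : 0 < N by rewrite lt_def Nn0.
  by rewrite -(ler_pM2r Np); nra.
- move=> i; have [iT0|iT0] := boolP (i \in T0).
    by apply: le_trans aN; exact: normr_le_restrict.
  by apply: le_trans bN; apply: Tmax; rewrite inE.
rewrite -{1}(restrict_toC S h) sqr_l2normD dotp_restrict_disjoint; last first.
  by rewrite disjoints_subset setCK.
rewrite mulr0 addr0 mulrDl mul1r lerD2l -exprMn.
by rewrite ler_sqr ?nnegrE ?l2norm_ge0 ?mulr_ge0.
Qed.

End RestrictedIsometry.

(** * Weighted l1 minimization *)

(** Only the comparison of the weighted norms of [y] and [x] is used, not the
    constraint defining the minimization. [c] is a lower bound on the weights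
    off the support of [x], and [C * c] an upper bound on the weights on the
    support. *)
Lemma weighted_l1_cone (R : realType) (n : nat) (w : 'I_n -> R)
    (x y : 'cV[R]_n) (c C : R) :
  let T0 := [set i | x i ord0 != 0] in
  weighted_l1 w y <= weighted_l1 w x -> 0 < c ->
  (forall i, 0 <= w i) ->
  (forall i, x i ord0 != 0 -> w i <= C * c) ->
  (forall i, x i ord0 = 0 -> c <= w i) ->
  \sum_(i in ~: T0) `|(y - x) i ord0| <= C * \sum_(i in T0) `|(y - x) i ord0|.
Proof.
move=> T0 wyx c0 w0 wT0 wC.
rewrite -(ler_pM2l c0) mulrCA mulrA !mulr_sumr.
apply: (@le_trans _ _ (\sum_(i in ~: T0) w i * `|y i ord0|)).
  apply: ler_sum => i; rewrite !inE negbK => /eqP xi0.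
  by rewrite !mxE xi0 subr0 ler_wpM2r // wC.
apply: (@le_trans _ _ (\sum_(i in T0) w i * (`|x i ord0| - `|y i ord0|))).
  have E f : \sum_i f i = \sum_(i in T0) f i + \sum_(i in ~: T0) f i :> R.
    by rewrite (bigID (mem T0)) /=; congr (_ + _);
      apply: eq_bigl => i; rewrite ?in_setC.
  move: wyx; rewrite /weighted_l1 !E.
  rewrite [X in _ <= _ + X]big1 ?addr0; last first.
    by move=> i; rewrite !inE negbK => /eqP ->; rewrite normr0 mulr0.
  rewrite -lerBrDl -sumrB; congr (_ <= _).
  by apply: eq_bigr => i _; rewrite mulrBr.
apply: ler_sum => i; rewrite inE => xi0.
apply: (@le_trans _ _ (w i * `|(y - x) i ord0|)).
  rewrite ler_wpM2l // !mxE distrC; exact: lerB_dist.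
by rewrite ler_wpM2r // wT0.
Qed.

(** * Convergence of the iteration *)

Lemma limn_esup_le_eventually (R : realType) (u : nat -> \bar R) (b : \bar R) K :
  (forall k, (K <= k)%N -> (u k <= b)%E) -> (limn_esup u <= b)%E.
Proof.
move=> ub; pose V : classical_sets.set nat := fun k => (K <= k)%N.
apply: (@le_trans _ _ (ereal_sup (classical_sets.image V u))).
  by apply: ereal_inf_lbound; exists V => //; exists K.
by apply: ge_ereal_sup => _ [k /= Kk <-]; exact: ub.
Qed.

Section IterationArithmetic.
Variable R : realType.
Implicit Types rho t N l a M A : R.

(** The error bound at a step with cone constant [(1 - rho) / 2]; here [t] stands
    for [alpha * eps] and [l] for the norm of the error. *)
Lemma final_error_le rho t N l :
  0 <= rho < 1 -> 0 <= N -> 0 <= l -> 0 <= t ->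
  (1 - rho * ((1 - rho) / 2)) * N <= t ->
  l ^+ 2 <= (1 + ((1 - rho) / 2) ^+ 2) * N ^+ 2 ->
  l <= 2 * t / (1 + rho).
Proof.
move=> /andP[rho0 rho1] N0 l0 t0 Nt lN.
(* sqrt (1 + y^2) <= 1 + y^2 / 2 at y = (1 - rho) / 2 *)
have lN' : l <= (1 + (1 - rho) ^+ 2 / 8) * N.
  rewrite -ler_sqr ?nnegrE //;
    last by rewrite mulr_ge0 // addr_ge0 // divr_ge0 // sqr_ge0.
  apply: le_trans lN _; rewrite [leRHS]exprMn ler_wpM2r ?sqr_ge0 //.
  by have := sqr_ge0 ((1 - rho) ^+ 2); nra.
rewrite ler_pdivlMr; last lra.
have : (1 + (1 - rho) ^+ 2 / 8) * (1 + rho) <= 2 * (1 - rho * ((1 - rho) / 2)).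
  have -> : 2 * (1 - rho * ((1 - rho) / 2)) =
      (1 + (1 - rho) ^+ 2 / 8) * (1 + rho) + (1 - rho) ^+ 2 * (7 - rho) / 8.
    by field.
  by rewrite lerDl divr_ge0 // mulr_ge0 ?sqr_ge0 //; lra.
by nra.
Qed.

(** The value of [A] is the entrywise error bound at a step with cone constant
    [2 / 5]; the conclusion makes [(1 - rho) / 2] a cone constant for the next
    step. *)
Lemma second_ratio_le rho M a A :
  0 <= rho < 1 -> 0 < M -> a <= (1 - rho) * M / 12 ->
  (1 - rho * (2 / 5)) * A = M * (1 - rho) / 4 ->
  A + a <= (1 - rho) / 2 * (M - A + a).
Proof.
move=> /andP[rho0 rho1] M0 aM AE.
have Arho : (3 - rho) * A <= 5 / 6 * (M * (1 - rho)).
  rewrite -(@ler_pM2l _ (1 - rho * (2 / 5))); last by lra.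
  have P : 0 <= M * (1 - rho) by rewrite mulr_ge0 //; lra.
  rewrite mulrCA AE.
  by nra.
nra.
Qed.

End IterationArithmetic.

Local Open Scope classical_set_scope.

Theorem theorem3p1 (R : realType) (m d s : nat) (Phi : 'M[R]_(m, d))
    (delta eps : R) (x : 'cV[R]_d) (e u : 'cV[R]_m)
    (a : nat -> R) (xhat : nat -> 'cV[R]_d) :
  let rho := Num.sqrt 2 * delta / (1 - delta) in
  let alpha := 2 * Num.sqrt (1 + delta) / (1 - delta) in
  let C := 2 * alpha / (1 + rho) in
  0 <= delta -> delta < Num.sqrt 2 - 1 ->
  restricted_isometry Phi (2 * s) delta ->
  sparse s x ->
  0 <= eps ->
  u = Phi *m x + e ->
  l2norm e <= eps ->
  ((4 * alpha * eps / (1 - rho))%:E <= min_nonzero_abs x)%E ->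
  (forall k : nat, 0 < a k) ->
  a k @[k --> \oo] --> 0 ->
  reweighted_l1_iterates Phi u eps a xhat ->
  (limn_esup (fun k : nat => (l2norm (x - xhat k))%:E) <= (C * eps)%:E)%E.
Proof.
move=> rho alpha C delta0 delta1 rip spx eps0 uE e_eps xmin a0 acv iter.
have sq2 : Num.sqrt 2 ^+ 2 = 2 :> R by rewrite sqr_sqrtr.
have sq2p : 0 < Num.sqrt 2 :> R by rewrite sqrtr_gt0.
have delta_lt1 : delta < 1 by nra.
have onemd : 0 < 1 - delta by lra.
have rho0 : 0 <= rho by rewrite divr_ge0 ?mulr_ge0 // ltW.
have rho1 : rho < 1 by rewrite ltr_pdivrMr // mul1r; nra.
have rhoP : 0 <= rho < 1 by rewrite rho0.
have alpha0 : 0 < alpha.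
  by rewrite divr_gt0 // mulr_gt0 // sqrtr_gt0; lra.
have rhoE : rho = Num.sqrt 2 * delta / (1 - delta) by [].
have alphaE : alpha = 2 * Num.sqrt (1 + delta) / (1 - delta) by [].
rewrite {}/C; clearbody rho alpha.
pose t := alpha * eps; have t0 : 0 <= t by rewrite mulr_ge0 // ltW.
(* M is used in place of the smallest nonzero entry of x, which is +oo for
   x = 0. *)
pose M := 4 * t / (1 - rho).
have M0 : 0 <= M by rewrite divr_ge0 ?mulr_ge0 //; lra.
have tE : t = M * (1 - rho) / 4 by rewrite /M; field; lra.
have xM i : x i ord0 != 0 -> M <= `|x i ord0|.
  move=> xi; rewrite -lee_fin /M /t mulrA.
  apply: le_trans xmin _.
  exact: (@bigmin_le_cond _ _ _ _ i).
pose h k := xhat k - x.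
pose T0 := [set i | x i ord0 != 0]%SET.
have cT0 : (#|T0| <= s)%N by rewrite cardsE.
have hfeas k : l2norm (Phi *m h k) <= 2 * eps.
  have [feas _] := iter k.
  have -> : Phi *m h k = (Phi *m xhat k - u) + e.
    by rewrite /h uE mulmxBr opprD addrA subrK.
  by apply: le_trans (l2normD_le _ _) _; lra.
have opt k : weighted_l1 (reweighted_weights a xhat k) (xhat k) <=
    weighted_l1 (reweighted_weights a xhat k) x.
  by have [_] := iter k; apply; rewrite uE opprD addrA subrr add0r l2normN.
pose cone k c :=
  \sum_(i in ~: T0) `|h k i ord0| <= c * \sum_(i in T0) `|h k i ord0|.
have bound k c : 0 <= c -> cone k c ->
    exists N, [/\ 0 <= N, (1 - rho * c) * N <= t, forall i, `|h k i ord0| <= N &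
      l2norm (h k) ^+ 2 <= (1 + c ^+ 2) * N ^+ 2].
  move=> c0 /(cone_error_bound delta0 rip c0 cT0)/(_ (hfeas k)).
  move=> [N [N0 Nle hN lN]]; exists N; split => //.
  rewrite -(ler_pM2l onemd).
  have -> : (1 - delta) * ((1 - rho * c) * N) =
      (1 - delta - Num.sqrt 2 * delta * c) * N by rewrite rhoE; field; lra.
  by apply: le_trans Nle _; rewrite /t alphaE le_eqVlt; apply/orP; left;
    apply/eqP; field; lra.
have next k c A : 0 <= A -> A <= M / 4 -> (forall i, `|h k i ord0| <= A) ->
    A + a k <= c * (M - A + a k) -> cone k.+1 c.
  move=> A_ge0 AM hA Ac; have ak := a0 k.
  have Aa : 0 < A + a k by lra.
  have MAa : 0 < M - A + a k by lra.
  have wpos i : 0 <= (`|xhat k i ord0| + a k)^-1.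
    by rewrite invr_ge0 addr_ge0 // ltW.
  apply: (@weighted_l1_cone _ _ _ _ _ (A + a k)^-1 _ (opt k.+1)) => //=.
  - by rewrite invr_gt0.
  - move=> i /xM xi; rewrite ler_pdivlMr //.
    have tri : `|x i ord0| <= `|xhat k i ord0| + `|xhat k i ord0 - x i ord0|.
      by rewrite -{1}(subKr (xhat k i ord0) (x i ord0)) ler_normB.
    have := hA i; rewrite /h !mxE => hi.
    rewrite mulrC ler_pdivrMr; last by lra.
    apply: (le_trans Ac).
    have c0 : 0 < c by rewrite -(pmulr_lgt0 _ MAa); exact: lt_le_trans Ac.
    by rewrite ler_pM2l //; lra.
  - move=> i xi; rewrite lef_pV2 ?posrE //; last by rewrite ltr_wpDl.
    by have := hA i; rewrite /h !mxE xi subr0 => hi; lra.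
have cone1 k : cone k 1.
  elim: k => [|k IH].
    apply: (@weighted_l1_cone _ _ _ _ _ 1 _ (opt 0)) => //= i _.
    by rewrite mulr1.
  have [N [N0 Nt hN _]] := bound _ _ ler01 IH.
  have NM : N <= M / 4.
    by rewrite -(@ler_pM2l _ (1 - rho)); [lra | lra].
  by apply: (next _ _ N) => //; lra.
(* The entrywise bound valid at every step. *)
have hM k i : `|h k i ord0| <= M / 4.
  have [N [N0 Nt hN _]] := bound _ _ ler01 (cone1 k).
  by apply: le_trans (hN i) _; rewrite -(@ler_pM2l _ (1 - rho)); lra.
(* For eps = 0 the thresholds below degenerate, but every error vanishes. *)
have [eps_eq0|eps_neq0] := eqVneq eps 0.
  apply: (@limn_esup_le_eventually _ _ _ 0) => k _.
  have M00 : M = 0 by rewrite /M /t eps_eq0 !mulr0 mul0r.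
  have hk0 : h k = 0.
    apply/matrixP => i j; rewrite ord1 [RHS]mxE; apply/eqP; rewrite -normr_le0.
    by apply: le_trans (hM k i) _; rewrite M00 mul0r.
  rewrite lee_fin -l2normN opprB -/(h k) hk0 eps_eq0 mulr0 le_l2norm //.
  by rewrite sqr_l2norm big1 ?expr0n // => i _; rewrite mxE expr0n.
have epsp : 0 < eps by rewrite lt_def eps_neq0.
have tp : 0 < t by rewrite mulr_gt0.
have Mp : 0 < M by rewrite divr_gt0 ?mulr_gt0 //; lra.
have eta0 : 0 < 1 - rho by lra.
(* Small enough for both steps: M / 12 is needed for the constant 2 / 5, and
   (1 - rho) * M / 12 for the constant (1 - rho) / 2. *)
have thr : 0 < (1 - rho) * M / 12 by apply: divr_gt0 => //; exact: mulr_gt0.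
have [K _ aK] : \forall k \near \oo, `|0 - a k| < (1 - rho) * M / 12.
  by move/cvgrPdist_lt : acv; exact.
have a_small k : (K <= k)%N -> a k <= (1 - rho) * M / 12.
  by move=> /aK /=; rewrite sub0r normrN gtr0_norm // => /ltW.
apply: (@limn_esup_le_eventually _ _ _ K.+2) => -[//|[//|k]]; rewrite !ltnS => Kk.
have cone2 : cone k.+1 (2 / 5).
  apply: (next _ _ (M / 4)) => //; first by lra.
  by have := a_small k Kk; have := a0 k; nra.
have [N [N0 Nt hN _]] := bound k.+1 (2 / 5) ltac:(lra) cone2.
pose A := t / (1 - rho * (2 / 5)).
have den : 0 < 1 - rho * (2 / 5) by lra.
have NA : N <= A by rewrite ler_pdivlMr // mulrC.
have cone3 : cone k.+2 ((1 - rho) / 2).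
  apply: (next _ _ A); first exact: le_trans NA.
  - by rewrite ler_pdivrMr // tE; nra.
  - by move=> i; exact: le_trans NA.
  apply: second_ratio_le => //; first exact/a_small/leqW.
  by rewrite -tE /A mulrCA divff ?mulr1 // gt_eqF.
have [N' [N'0 N't _ lN']] := bound k.+2 ((1 - rho) / 2) ltac:(lra) cone3.
rewrite lee_fin -l2normN opprB -/(h _).
have -> : 2 * alpha / (1 + rho) * eps = 2 * t / (1 + rho) by rewrite /t; field; lra.
exact: (final_error_le rhoP N'0 (l2norm_ge0 _) t0 N't lN').
Qed.
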